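(* Let $\lambda$ be a nonzero real number. For every $n \in \mathbb{N}$, \[ H_{n,\lambda}= \frac{1}{n!}\sum_{k=1}^n k\, (1)_{k-1,-\lambda}\begin{bmatrix}n\\ k\end{bmatrix}_\lambda. \]
   Context: For real $x$ and integer $k\ge0$, $\binom{x}{k}=\frac{x(x-1)\cdots(x-k+1)}{k!}$. Degenerate falling factorials: $(x)_{0,\mu}=1$, $(x)_{n,\mu}=x(x-\mu)(x-2\mu)\cdots(x-(n-1)\mu)$ for $n\ge1$; so $(1)_{k,-\lambda}=1(1+\lambda)\cdots(1+(k-1)\lambda)$. The degenerate logarithm is $\log_\lambda(1+t)=\frac{(1+t)^\lambda-1}{\lambda}=\sum_{n=1}^\infty\binom{\lambda-1}{n-1}\frac{t^n}{n}$. The unsigned degenerate Stirling numbers of the first kind ${n\brack k}_\lambda$ are defined by $\frac{1}{k!}\big(-\log_\lambda(1-t)\big)^k=\sum_{n=k}^\infty {n\brack k}_\lambda\frac{t^n}{n!}$ for $k\ge0$. The degenerate harmonic numbers are $H_{0,\lambda}=0$ and $H_{n,\lambda}=\sum_{k=1}^{n}\binom{\lambda-1}{k-1}\frac{(-1)^{k-1}}{k}$ for $n\in\mathbb{N}$. *)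

(* Defs.v *)
From Stdlib Require Import Reals Lra Lia Factorial Arith.
From Coquelicot Require Import Coquelicot.
Open Scope R_scope.

(* Degenerate falling factorial (x)_{n,mu} = x (x - mu) ... (x - (n-1) mu). *)
Fixpoint dfalling (x mu : R) (n : nat) : R :=
  match n with
  | O => 1
  | S m => dfalling x mu m * (x - INR m * mu)
  end.

(* Binomial coefficient with a real upper argument. *)
Definition rbinom (x : R) (k : nat) : R := dfalling x 1 k / INR (fact k).

(* log_lambda y = (y^lambda - 1) / lambda.  [Rpower] is the real power for
   0 < y, the only case used below. *)
Definition deg_log (lambda y : R) : R := (Rpower y lambda - 1) / lambda.

(* Formal power series are coefficient sequences [nat -> R], with Coquelicot's
   operations [PS_mult], [PS_scal], [PS_opp]. *)

(* Coefficients in t of log_lambda (1 + t). *)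
Definition deg_log_series (lambda : R) (n : nat) : R :=
  match n with
  | O => 0
  | S m => rbinom (lambda - 1) m / INR (S m)
  end.

(* The substitution t |-> - t. *)
Definition PS_neg_arg (a : nat -> R) (n : nat) : R := (-1) ^ n * a n.

Fixpoint PS_pow (a : nat -> R) (k : nat) : nat -> R :=
  match k with
  | O => fun n => match n with O => 1 | S _ => 0 end
  | S j => PS_mult a (PS_pow a j)
  end.

(* The series (1 / k!) (- log_lambda (1 - t))^k. *)
Definition deg_stirling1_egf (lambda : R) (k : nat) : nat -> R :=
  PS_scal (/ INR (fact k))
    (PS_pow (PS_opp (PS_neg_arg (deg_log_series lambda))) k).

(* Unsigned degenerate Stirling number of the first kind [n, k]_lambda:
   n! times the coefficient of t^n in the series above.  [deg_stirling1_gf]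
   below shows that the generating function identity also holds for the actual
   functions of t near 0. *)
Definition deg_stirling1 (lambda : R) (n k : nat) : R :=
  INR (fact n) * deg_stirling1_egf lambda k n.

(* Degenerate harmonic number; the sum is empty for n = 0. *)
Definition deg_harmonic (lambda : R) (n : nat) : R :=
  sum_n_m (fun k => rbinom (lambda - 1) (k - 1) * ((-1) ^ (k - 1) / INR k)) 1 n.

Lemma rbinom_S x n : INR (S n) * rbinom x (S n) = (x - INR n) * rbinom x n.
Proof.
unfold rbinom; cbn [dfalling].
change (fact (S n)) with (S n * fact n)%nat; rewrite mult_INR.
assert (H := INR_fact_neq_0 n).
assert (H' : INR (S n) <> 0) by (apply not_0_INR; lia).
field; auto.
Qed.

Lemma rbinom_bound x n : Rabs (rbinom x n) <= (Rabs x + 1) ^ n.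
Proof.
assert (hx := Rabs_pos x).
induction n as [|n IH].
- unfold rbinom; simpl. unfold Rdiv; rewrite Rinv_1, Rmult_1_l, Rabs_R1; lra.
- assert (hn := pos_INR n).
  assert (E : INR (S n) * Rabs (rbinom x (S n))
              = Rabs (x - INR n) * Rabs (rbinom x n)).
  { rewrite <- Rabs_mult, <- rbinom_S, Rabs_mult.
    rewrite (Rabs_pos_eq (INR (S n))); auto using pos_INR. }
  assert (B : Rabs (x - INR n) <= INR (S n) * (Rabs x + 1)).
  { eapply Rle_trans; [apply Rabs_triang|].
    rewrite Rabs_Ropp, (Rabs_pos_eq _ hn), S_INR; nra. }
  assert (hS : 0 < INR (S n)) by (apply lt_0_INR; lia).
  apply Rmult_le_reg_l with (INR (S n)); auto.
  rewrite E; simpl pow; rewrite <- Rmult_assoc.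
  apply Rmult_le_compat; auto using Rabs_pos.
Qed.

Lemma deg_log_series_radius lambda :
  Rbar_le (/ (Rabs (lambda - 1) + 1)) (CV_radius (deg_log_series lambda)).
Proof.
assert (hx := Rabs_pos (lambda - 1)).
set (K := Rabs (lambda - 1) + 1).
apply (proj1 (CV_radius_bounded _)); exists 1; intros n.
assert (hK : 1 <= K) by (unfold K; lra).
assert (hKn : 0 < K ^ n) by (apply pow_lt; lra).
rewrite Rabs_mult, <- RPow_abs, (Rabs_pos_eq (/ K)), pow_inv;
  [|apply Rlt_le, Rinv_0_lt_compat; lra].
apply Rmult_le_reg_r with (K ^ n); auto.
rewrite Rmult_assoc, Rinv_l, Rmult_1_r, Rmult_1_l by lra.
destruct n as [|m]; simpl.
- rewrite Rabs_R0; lra.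
- assert (hb := rbinom_bound (lambda - 1) m); fold K in hb.
  change (match m with O => 1 | S _ => INR m + 1 end) with (INR (S m)).
  assert (hS : 1 <= INR (S m)) by (rewrite S_INR; generalize (pos_INR m); lra).
  unfold Rdiv; rewrite Rabs_mult, Rabs_inv, (Rabs_pos_eq (INR (S m))) by lra.
  assert (hi : / INR (S m) <= 1) by (rewrite <- Rinv_1; apply Rinv_le_contravar; lra).
  assert (hi0 : 0 < / INR (S m)) by (apply Rinv_0_lt_compat; lra).
  assert (hm : 0 < K ^ m) by (apply pow_lt; lra).
  generalize (Rabs_pos (rbinom (lambda - 1) m)); nra.
Qed.

Lemma deg_log_series_ode lambda t :
  Rbar_lt (Rabs t) (CV_radius (deg_log_series lambda)) ->
  (1 + t) * PSeries (PS_derive (deg_log_series lambda)) t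
  = 1 + lambda * PSeries (deg_log_series lambda) t.
Proof.
set (a := deg_log_series lambda); intros ht.
assert (hd : ex_pseries (PS_derive a) t)
  by (apply CV_radius_inside; rewrite CV_radius_derive; exact ht).
assert (ha : ex_pseries a t) by (apply CV_radius_inside; exact ht).
set (e := fun n : nat => match n with O => 1 | S _ => 0 end).
assert (he : is_pseries e t 1).
{ rewrite <- (Rplus_0_r 1).
  apply is_pseries_R.
  apply filterlim_ext with (fun _ : nat => 1 + 0); [|apply filterlim_const].
  intros n; induction n as [|n IH].
  - rewrite sum_O; simpl; ring.
  - rewrite sum_Sn, <- IH; unfold e, plus; simpl; ring. }
assert (H1 : is_pseries (PS_plus (PS_derive a) (PS_incr_1 (PS_derive a))) t
          (PSeries (PS_derive a) t + t * PSeries (PS_derive a) t)).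
{ apply (is_pseries_plus (V := R_NormedModule));
    [apply PSeries_correct, hd|].
  apply (is_pseries_incr_1 (V := R_NormedModule)); apply PSeries_correct, hd. }
assert (H2 : is_pseries (PS_plus e (PS_scal lambda a)) t (1 + lambda * PSeries a t)).
{ apply (is_pseries_plus (V := R_NormedModule)); [exact he|].
  apply (is_pseries_scal (V := R_NormedModule));
    [apply Rmult_comm | apply PSeries_correct, ha]. }
apply is_pseries_unique in H1; apply is_pseries_unique in H2.
transitivity (PSeries (PS_derive a) t + t * PSeries (PS_derive a) t); [ring|].
rewrite <- H1, <- H2; apply PSeries_ext; intros n.
unfold PS_plus, PS_incr_1, PS_scal, PS_derive, a, e, plus, scal, mult, zero.
cbn -[INR rbinom].
destruct n as [|n]; cbn -[INR rbinom].
- unfold rbinom; simpl; field.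
- assert (hS : INR (S n) <> 0) by (apply not_0_INR; lia).
  assert (hSS : INR (S (S n)) <> 0) by (apply not_0_INR; lia).
  assert (E := rbinom_S (lambda - 1) n).
  transitivity (rbinom (lambda - 1) (S n) + rbinom (lambda - 1) n).
  { unfold mult; simpl mult. field; auto. }
  apply Rmult_eq_reg_l with (INR (S n)); auto.
  rewrite Rmult_plus_distr_l, E.
  field_simplify; auto. rewrite ?S_INR. ring.
Qed.

Lemma is_pseries_deg_log lambda t :
  lambda <> 0 -> Rabs t < / (Rabs (lambda - 1) + 1) ->
  is_pseries (deg_log_series lambda) t (deg_log lambda (1 + t)).
Proof.
intros hl ht.
assert (hx := Rabs_pos (lambda - 1)).
set (r := / (Rabs (lambda - 1) + 1)) in *.
assert (hr1 : r <= 1)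
  by (rewrite <- Rinv_1; apply Rinv_le_contravar; lra).
set (a := deg_log_series lambda).
assert (hin : forall s, Rabs s < r -> Rbar_lt (Rabs s) (CV_radius a)).
{ intros s hs; apply Rbar_lt_le_trans with r; [exact hs|].
  apply deg_log_series_radius. }
set (G := fun s => (1 + lambda * PSeries a s) * Rpower (1 + s) (- lambda)).
assert (dG : forall s, Rabs s < r -> is_derive G s zero).
{ intros s hs.
  assert (hs1 : 0 < 1 + s) by (apply Rabs_def2 in hs; lra).
  assert (D1 := is_derive_PSeries a s (hin s hs)).
  assert (O := deg_log_series_ode lambda s (hin s hs)); fold a in O.
  assert (D2 : is_derive (fun s => Rpower (1 + s) (- lambda)) s
                 (- lambda * / (1 + s) * Rpower (1 + s) (- lambda))).
  { unfold Rpower; auto_derive; [exact hs1|field; lra]. }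
  assert (D3 : is_derive (fun s => 1 + lambda * PSeries a s) s
                 (0 + lambda * PSeries (PS_derive a) s)).
  { apply (is_derive_plus (V := R_NormedModule)); [apply (is_derive_const (V := R_NormedModule))|].
    apply is_derive_scal; exact D1. }
  assert (D := is_derive_mult _ _ s _ _ D3 D2 Rmult_comm).
  unfold plus, mult in D; simpl in D.
  replace (@zero R_NormedModule) with
   ((0 + lambda * PSeries (PS_derive a) s) * Rpower (1 + s) (- lambda) +
    (1 + lambda * PSeries a s) * (- lambda * / (1 + s) * Rpower (1 + s) (- lambda)));
    [exact D|].
  rewrite <- O; change (@zero R_NormedModule) with 0; field; apply Rgt_not_eq; exact hs1. }
assert (G0 : G 0 = 1).
{ unfold G; rewrite PSeries_0, Rplus_0_r.
  unfold a, Rpower; simpl; rewrite ln_1, !Rmult_0_r, exp_0; ring. }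
assert (Gt : G t = 1).
{ rewrite <- G0; destruct (Rtotal_order t 0) as [h|[->|h]]; [|reflexivity|].
  - apply (eq_is_derive (V := R_NormedModule)); auto; intros s hs; apply dG.
    apply Rabs_def2 in ht; apply Rabs_def1; lra.
  - symmetry; apply (eq_is_derive (V := R_NormedModule)); auto; intros s hs; apply dG.
    apply Rabs_def2 in ht; apply Rabs_def1; lra. }
replace (deg_log lambda (1 + t)) with (PSeries a t).
{ apply PSeries_correct, CV_radius_inside, hin, ht. }
unfold G in Gt; unfold deg_log.
assert (E : Rpower (1 + t) lambda * Rpower (1 + t) (- lambda) = 1).
{ rewrite <- Rpower_plus, Rplus_opp_r; unfold Rpower.
  rewrite Rmult_0_l; apply exp_0. }
replace (Rpower (1 + t) lambda) with (1 + lambda * PSeries a t); [field; auto|].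
apply Rmult_eq_reg_r with (Rpower (1 + t) (- lambda)).
- rewrite Gt, E; reflexivity.
- unfold Rpower; generalize (exp_pos (- lambda * ln (1 + t))); lra.
Qed.

Lemma is_pseries_neg_arg a t l :
  is_pseries a (- t) l -> is_pseries (PS_neg_arg a) t l.
Proof.
rewrite !is_pseries_R; apply is_series_ext; intros n.
unfold PS_neg_arg; replace (- t) with (-1 * t) by ring.
rewrite Rpow_mult_distr; simpl; ring.
Qed.

Lemma pseries_radius_gt a r t (f : R -> R) :
  (forall s, Rabs s < r -> is_pseries a s (f s)) ->
  Rabs t < r -> Rbar_lt (Rabs t) (CV_radius a).
Proof.
intros h ht.
assert (ht0 := Rabs_pos t).
set (u := (Rabs t + r) / 2).
assert (hu : Rabs u = u) by (apply Rabs_pos_eq; unfold u; lra).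
apply Rbar_lt_le_trans with u; [simpl; unfold u; lra|].
apply Rbar_not_lt_le; intros hc; rewrite <- hu in hc.
apply (CV_disk_outside _ _ hc).
apply ex_series_lim_0; exists (f u).
apply is_pseries_R, h; rewrite hu; unfold u; lra.
Qed.

Lemma is_pseries_PS_pow a r (f : R -> R) k :
  (forall s, Rabs s < r -> is_pseries a s (f s)) ->
  forall s, Rabs s < r -> is_pseries (PS_pow a k) s (f s ^ k).
Proof.
intros h; induction k as [|k IH]; intros s hs.
- apply is_pseries_R.
  apply filterlim_ext with (fun _ : nat => 1); [|apply filterlim_const].
  intros n; induction n as [|n IHn].
  + rewrite sum_O; simpl; ring.
  + rewrite sum_Sn, <- IHn; unfold plus; simpl; ring.
- apply is_pseries_mult; auto.
  + exact (pseries_radius_gt a r s f h hs).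
  + exact (pseries_radius_gt _ r s _ IH hs).
Qed.

Theorem deg_stirling1_gf lambda k :
  lambda <> 0 ->
  locally 0 (fun t =>
    is_series (fun n => deg_stirling1 lambda n k * (t ^ n / INR (fact n)))
      (/ INR (fact k) * (- deg_log lambda (1 - t)) ^ k)).
Proof.
intros hl.
assert (hx := Rabs_pos (lambda - 1)).
assert (hr : 0 < / (Rabs (lambda - 1) + 1)) by (apply Rinv_0_lt_compat; lra).
exists (mkposreal _ hr); intros t ht.
assert (ht' : Rabs t < / (Rabs (lambda - 1) + 1)).
{ change (Rabs (t - 0) < / (Rabs (lambda - 1) + 1)) in ht.
  rewrite Rminus_0_r in ht; exact ht. }
apply is_series_ext with
  (fun n => deg_stirling1_egf lambda k n * t ^ n).
{ intros n; unfold deg_stirling1; assert (H := INR_fact_neq_0 n); simpl; field; auto. }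
apply is_pseries_R.
apply (is_pseries_scal (V := R_NormedModule)); [apply Rmult_comm|].
apply (is_pseries_PS_pow _ (/ (Rabs (lambda - 1) + 1))
         (fun t => - deg_log lambda (1 - t))); auto.
intros s hs; apply (is_pseries_opp (V := R_NormedModule)), is_pseries_neg_arg.
apply is_pseries_deg_log; auto; rewrite Rabs_Ropp; auto.
Qed.

Lemma PS_mult_low a b i j n :
  (forall m, (m < i)%nat -> a m = 0) -> (forall m, (m < j)%nat -> b m = 0) ->
  (n < i + j)%nat -> PS_mult a b n = 0.
Proof.
intros ha hb hn; unfold PS_mult.
rewrite (sum_eq _ (fun _ => 0)).
- rewrite sum_cte; ring.
- intros m hm; destruct (Nat.lt_ge_cases m i) as [h|h].
  + rewrite (ha m h); ring.
  + rewrite (hb (n - m)%nat); [ring|lia].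
Qed.

(* Hence the generating series effectively starts at n = k. *)
Lemma deg_stirling1_small lambda n k :
  (n < k)%nat -> deg_stirling1 lambda n k = 0.
Proof.
intros h; unfold deg_stirling1, deg_stirling1_egf.
set (a := PS_opp (PS_neg_arg (deg_log_series lambda))).
enough (E : forall m, (m < k)%nat -> PS_pow a k m = 0).
{ unfold PS_scal; rewrite (E n h).
  change (INR (fact n) * (/ INR (fact k) * 0) = 0); ring. }
clear n h; induction k as [|k IH]; intros m hm; [lia|].
apply (PS_mult_low _ _ 1 k); auto.
intros [|q] hq; [|lia].
change (- (1 * 0) = 0); ring.
Qed.

(* Main.v *)
Require Import Defs.
From Stdlib Require Import Reals Factorial.
From Stdlib Require Import Lra Lia.
From Coquelicot Require Import Coquelicot.
Open Scope R_scope.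

(** Put [L = - log_lambda (1 - t)], so that [(1 - t) L' = 1 - lambda L], and
    [d_k = (1)_{k,-lambda} / k!].  The series [G = sum_k d_k L^k] is
    [(1 - lambda L)^(- 1 / lambda)], which is [1 / (1 - t)]; formally, the
    recurrence of the [d_k] gives [(1 - t) G' = G].  After division by [n!] the
    right-hand side is the coefficient of [t^n] in [L G = L / (1 - t)], which is
    a partial sum of the coefficients of [L]. *)

(** Written exactly as the base of the power in [deg_stirling1_egf], so that [deg_stirling1] unfolds
    to powers of L by conversion. *)
Definition neg_deg_log (lambda : R) : nat -> R :=
  PS_opp (PS_neg_arg (deg_log_series lambda)).

(* The derivation [(1 - t) d/dt] on coefficient sequences. *)
Definition PS_deriv1 (a : nat -> R) (n : nat) : R :=
  INR (S n) * a (S n) - INR n * a n.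

(** * Cauchy products and the derivation *)

Lemma PS_mult_one_l a b n : PS_mult (PS_pow a 0) b n = b n.
Proof.
unfold PS_mult; destruct n as [|n]; [simpl; ring|].
rewrite decomp_sum by lia; simpl pred.
rewrite (sum_eq _ (fun _ => 0)) by (intros; simpl; ring).
rewrite sum_cte; simpl; ring.
Qed.

Lemma PS_mult_one_r a b n : PS_mult a (PS_pow b 0) n = a n.
Proof.
unfold PS_mult; destruct n as [|n]; [simpl; ring|].
rewrite tech5, Nat.sub_diag, (sum_eq _ (fun _ => 0)).
- rewrite sum_cte; simpl; ring.
- intros m hm; rewrite Nat.sub_succ_l by assumption; simpl; ring.
Qed.

Lemma PS_mult_ext a a' b b' n :
  (forall m, a m = a' m) -> (forall m, b m = b' m) ->
  PS_mult a b n = PS_mult a' b' n.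
Proof.
intros ha hb; unfold PS_mult; apply sum_eq; intros m _.
rewrite ha, hb; reflexivity.
Qed.

Lemma PS_mult_lin_l a a' b c n :
  PS_mult (fun m => a m - c * a' m) b n = PS_mult a b n - c * PS_mult a' b n.
Proof.
unfold PS_mult; rewrite scal_sum, <- minus_sum; apply sum_eq; intros m _; ring.
Qed.

Lemma PS_mult_lin_r a b b' c d n :
  PS_mult a (fun m => d * (b m - c * b' m)) n
  = d * (PS_mult a b n - c * PS_mult a b' n).
Proof.
unfold PS_mult.
rewrite (scal_sum _ n c), <- minus_sum, scal_sum; apply sum_eq; intros m _; ring.
Qed.

(** Leibniz rule. The weight of a convolution term is the sum of its two indices; splitting it gives
    the rule for t d/dt ([T]) and for d/dt ([D]), whose difference is the claim. *)
Lemma PS_deriv1_mult a b n :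
  PS_deriv1 (PS_mult a b) n
  = PS_mult (PS_deriv1 a) b n + PS_mult a (PS_deriv1 b) n.
Proof.
assert (T : INR n * PS_mult a b n
  = PS_mult (fun m => INR m * a m) b n + PS_mult a (fun m => INR m * b m) n).
{ unfold PS_mult; rewrite scal_sum, <- plus_sum; apply sum_eq; intros m hm.
  rewrite minus_INR by assumption; ring. }
assert (D : INR (S n) * PS_mult a b (S n)
  = PS_mult (fun m => INR (S m) * a (S m)) b n
    + PS_mult a (fun m => INR (S m) * b (S m)) n).
{ unfold PS_mult.
  transitivity (sum_f_R0 (fun m => INR m * a m * b (S n - m)%nat) (S n)
              + sum_f_R0 (fun m => a m * (INR (S n - m) * b (S n - m)%nat)) (S n)).
  { rewrite scal_sum, <- plus_sum; apply sum_eq; intros m hm.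
    rewrite minus_INR by assumption; ring. }
  f_equal.
  (* Each sum loses its term of weight 0, at m = 0 here and at m = n + 1 below. *)
  - rewrite decomp_sum by lia; simpl pred.
    change (INR 0) with 0; rewrite !Rmult_0_l, Rplus_0_l; reflexivity.
  - rewrite tech5, Nat.sub_diag; change (INR 0) with 0.
    rewrite Rmult_0_l, Rmult_0_r, Rplus_0_r; apply sum_eq; intros m hm.
    rewrite Nat.sub_succ_l by assumption; reflexivity. }
unfold PS_deriv1 at 1; rewrite T, D; unfold PS_mult, PS_deriv1.
rewrite <- !plus_sum, <- minus_sum; apply sum_eq; intros m _; ring.
Qed.

(** * The series L and its powers *)

Lemma neg_deg_log_0 lambda : neg_deg_log lambda 0 = 0.
Proof. change (- (1 * 0) = 0); ring. Qed.

(** These are the summands of [deg_harmonic], which is thus a partial sum of coefficients of L. *)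
Lemma neg_deg_log_S lambda m :
  neg_deg_log lambda (S m) = rbinom (lambda - 1) m * ((-1) ^ m / INR (S m)).
Proof.
change (- ((-1 * (-1) ^ m) * (rbinom (lambda - 1) m / INR (S m)))
  = rbinom (lambda - 1) m * ((-1) ^ m / INR (S m))).
unfold Rdiv; ring.
Qed.

(** In positive degree, (1 - t) L' = 1 - lambda L comes from the recurrence [rbinom_S]. *)
Lemma neg_deg_log_ode lambda n :
  PS_deriv1 (neg_deg_log lambda) n
  = PS_pow (neg_deg_log lambda) 0 n - lambda * neg_deg_log lambda n.
Proof.
unfold PS_deriv1; destruct n as [|m].
- rewrite neg_deg_log_0, neg_deg_log_S; unfold rbinom; simpl; field.
- rewrite !neg_deg_log_S; simpl PS_pow.
  assert (h : INR (S m) <> 0) by (apply not_0_INR; lia).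
  assert (h' : INR (S (S m)) <> 0) by (apply not_0_INR; lia).
  assert (E : rbinom (lambda - 1) (S m)
    = (lambda - 1 - INR m) * rbinom (lambda - 1) m / INR (S m)).
  { rewrite <- rbinom_S; field; assumption. }
  rewrite E; change ((-1) ^ S m) with (-1 * (-1) ^ m).
  field_simplify; auto; rewrite (S_INR m) in *; field; auto.
Qed.

Lemma PS_pow_low lambda k n :
  (n < k)%nat -> PS_pow (neg_deg_log lambda) k n = 0.
Proof.
revert n; induction k as [|k IH]; intros n hn; [lia|].
apply (PS_mult_low _ _ 1 k); auto.
intros [|m] hm; [apply neg_deg_log_0|lia].
Qed.

(* Coefficientwise, [(1 - t) (L^(k+1))' = (k+1) (L^k - lambda L^(k+1))]. *)
Lemma PS_deriv1_pow lambda k n :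
  PS_deriv1 (PS_pow (neg_deg_log lambda) (S k)) n
  = INR (S k) * (PS_pow (neg_deg_log lambda) k n
                 - lambda * PS_pow (neg_deg_log lambda) (S k) n).
Proof.
set (L := neg_deg_log lambda).
revert n; induction k as [|k IH]; intros n.
- change (PS_pow L 1) with (PS_mult L (PS_pow L 0)).
  unfold PS_deriv1; rewrite !PS_mult_one_r.
  change (PS_deriv1 L n = INR 1 * (PS_pow L 0 n - lambda * L n)).
  unfold L; rewrite neg_deg_log_ode; simpl INR; ring.
- change (PS_pow L (S (S k))) with (PS_mult L (PS_pow L (S k))).
  (* Leibniz gives (1 - lambda L) L^(k+1) + (k+1) L (L^k - lambda L^(k+1)), which collects to the
     factor k + 2. *)
  rewrite PS_deriv1_mult.
  rewrite (PS_mult_ext _ (fun m => PS_pow L 0 m - lambda * L m)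
             _ (PS_pow L (S k)) n (neg_deg_log_ode lambda)) by reflexivity.
  rewrite (PS_mult_ext L L _ _ n (fun _ => eq_refl) IH).
  rewrite PS_mult_lin_l, PS_mult_lin_r, PS_mult_one_l.
  change (PS_mult L (PS_pow L k) n) with (PS_pow L (S k) n).
  rewrite (S_INR (S k)); ring.
Qed.

(** * The series G *)

(** The part k lambda d_k is what cancels the [lambda] term of [PS_deriv1_pow] after summation over
    k. *)
Lemma dfalling_div_fact_S lambda k :
  INR (S k) * (dfalling 1 (- lambda) (S k) / INR (fact (S k)))
  = (1 + INR k * lambda) * (dfalling 1 (- lambda) k / INR (fact k)).
Proof.
cbn [dfalling]; change (fact (S k)) with (S k * fact k)%nat; rewrite mult_INR.
assert (H := INR_fact_neq_0 k).
assert (H' : INR (S k) <> 0) by (apply not_0_INR; lia).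
field; auto.
Qed.

(* The coefficients of [G = sum_k d_k L^k] are those of [1 / (1 - t)]; as
   [L^k] starts at [t^k], any [N >= n] truncates the sum exactly. *)
Lemma dfalling_pow_sum lambda N n :
  (n <= N)%nat ->
  sum_f_R0 (fun k => dfalling 1 (- lambda) k / INR (fact k)
                     * PS_pow (neg_deg_log lambda) k n) N = 1.
Proof.
set (d := fun k => dfalling 1 (- lambda) k / INR (fact k)).
set (p := PS_pow (neg_deg_log lambda)).
change ((n <= N)%nat -> sum_f_R0 (fun k => d k * p k n) N = 1).
induction n as [|n IH]; intros hN.
- destruct N as [|N]; [unfold d, p; simpl; field|].
  rewrite decomp_sum by lia; simpl pred.
  rewrite (sum_eq _ (fun _ => 0))
    by (intros; unfold p; rewrite PS_pow_low by lia; ring).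
  rewrite sum_cte; unfold d, p; simpl; field.
- destruct N as [|N]; [lia|].
  specialize (IH ltac:(lia)).
  assert (hS : INR (S n) <> 0) by (apply not_0_INR; lia).
  (* With c_n the coefficient of t^n in G, the plan is (n+1) c_(n+1) = n c_n + c_n. *)
  apply Rmult_eq_reg_l with (INR (S n)); auto.
  rewrite decomp_sum by lia; simpl pred.
  replace (p 0%nat (S n)) with 0 by reflexivity.
  rewrite Rmult_0_r, Rplus_0_l, scal_sum.
  (* The two sums carrying [lambda] differ by an index shift and cancel ([C]); the other two give 1
     ([A]) and n ([B]). *)
  rewrite (sum_eq _ (fun k =>
     (d k * p k n + lambda * (INR k * d k * p k n))
     + (INR n * (d (S k) * p (S k) n)
        - lambda * (INR (S k) * d (S k) * p (S k) n)))).
  2:{ intros k _.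
    assert (E := PS_deriv1_pow lambda k n); fold p in E; unfold PS_deriv1 in E.
    assert (F := dfalling_div_fact_S lambda k); fold (d k) (d (S k)) in F.
    replace (d (S k) * p (S k) (S n) * INR (S n))
      with (d (S k) * (INR (S n) * p (S k) (S n))) by ring.
    replace (INR (S n) * p (S k) (S n)) with
      (INR n * p (S k) n + INR (S k) * (p k n - lambda * p (S k) n)) by lra.
    replace (d (S k) * (INR n * p (S k) n
                        + INR (S k) * (p k n - lambda * p (S k) n)))
      with (INR n * (d (S k) * p (S k) n) + (INR (S k) * d (S k)) * p k n
            - lambda * (INR (S k) * d (S k) * p (S k) n)) by ring.
    rewrite F; ring. }
  assert (top : p (S N) n = 0) by (apply PS_pow_low; lia).
  assert (A : sum_f_R0 (fun k => d k * p k n) N = 1).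
  { rewrite tech5, top in IH; lra. }
  assert (B : INR n * sum_f_R0 (fun k => d (S k) * p (S k) n) N = INR n).
  { rewrite decomp_sum in IH by lia; simpl pred in IH.
    (* The missing term k = 0 is harmless: for n = 0 the factor n kills it, otherwise it is a
       positive-degree coefficient of 1. *)
    destruct n as [|n]; [simpl; ring|].
    replace (p 0%nat (S n)) with 0 in IH by reflexivity.
    rewrite Rmult_0_r, Rplus_0_l in IH; rewrite IH; ring. }
  assert (C : sum_f_R0 (fun k => INR (S k) * d (S k) * p (S k) n) N
              = sum_f_R0 (fun k => INR k * d k * p k n) N).
  { assert (E := tech5 (fun k => INR k * d k * p k n) N); cbv beta in E.
    rewrite decomp_sum in E by lia; simpl pred in E.
    rewrite top in E; change (INR 0) with 0 in E; lra. }
  rewrite plus_sum, plus_sum, minus_sum, A.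
  rewrite (sum_eq (fun k => lambda * (INR k * d k * p k n))
             (fun k => INR k * d k * p k n * lambda)) by (intros; ring).
  rewrite (sum_eq (fun k => INR n * (d (S k) * p (S k) n))
             (fun k => d (S k) * p (S k) n * INR n)) by (intros; ring).
  rewrite (sum_eq (fun k => lambda * (INR (S k) * d (S k) * p (S k) n))
             (fun k => INR (S k) * d (S k) * p (S k) n * lambda))
    by (intros; ring).
  rewrite <- !scal_sum, B, C, S_INR; ring.
Qed.

Lemma sum_f_R0_swap (f : nat -> nat -> R) m n :
  sum_f_R0 (fun i => sum_f_R0 (f i) n) m
  = sum_f_R0 (fun j => sum_f_R0 (fun i => f i j) m) n.
Proof.
induction m as [|m IH]; [reflexivity|].
rewrite tech5, IH, <- plus_sum; apply sum_eq; intros j _.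
reflexivity.
Qed.

Theorem theorem2p10 (lambda : R) (hlambda : lambda <> 0) (n : nat) (hn : (1 <= n)%nat) :
  deg_harmonic lambda n =
  / INR (fact n) *
  sum_n_m (fun k => INR k * dfalling 1 (- lambda) (k - 1) * deg_stirling1 lambda n k) 1 n.
Proof.
destruct n as [|N]; [lia|].
set (L := neg_deg_log lambda).
set (d := fun k => dfalling 1 (- lambda) k / INR (fact k)).
unfold deg_harmonic; rewrite <- !sum_n_m_S.
change (sum_n (fun k => rbinom (lambda - 1) (S k - 1)
                        * ((-1) ^ (S k - 1) / INR (S k))) N
  = / INR (fact (S N)) *
    sum_n (fun k => INR (S k) * dfalling 1 (- lambda) (S k - 1)
                    * deg_stirling1 lambda (S N) (S k)) N).
rewrite !sum_n_Reals, scal_sum.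
(* Both sides equal this expansion of the coefficient of t^(N+1) in L G, without the zero constant
   term of L. *)
transitivity (sum_f_R0 (fun k => sum_f_R0 (fun i =>
    d k * (L (S i) * PS_pow L k (N - i)%nat)) N) N).
- rewrite sum_f_R0_swap; apply sum_eq; intros i hi.
  rewrite (sum_eq _ (fun k => d k * PS_pow L k (N - i)%nat * L (S i)))
    by (intros; ring).
  (* Truncating G at k = N is exact, as the degree N - i is at most N. *)
  rewrite <- scal_sum; unfold d, L; rewrite dfalling_pow_sum by lia.
  rewrite neg_deg_log_S; simpl; rewrite Nat.sub_0_r; ring.
- apply sum_eq; intros k _.
  rewrite (sum_eq _ (fun i => L (S i) * PS_pow L k (N - i)%nat * d k))
    by (intros; ring).
  rewrite <- scal_sum.
  replace (sum_f_R0 (fun i => L (S i) * PS_pow L k (N - i)%nat) N)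
    with (PS_pow L (S k) (S N)).
  2:{ change (PS_mult L (PS_pow L k) (S N)
        = sum_f_R0 (fun i => L (S i) * PS_pow L k (N - i)%nat) N).
      unfold PS_mult; rewrite decomp_sum by lia; simpl pred.
      unfold L at 1; rewrite neg_deg_log_0, Rmult_0_l, Rplus_0_l; reflexivity. }
  change (deg_stirling1 lambda (S N) (S k)) with
    (INR (fact (S N)) * (/ INR (fact (S k)) * PS_pow L (S k) (S N))).
  replace (S k - 1)%nat with k by lia.
  (* The weight k + 1 cancels against (k+1)! and leaves d_k. *)
  change (fact (S k)) with (S k * fact k)%nat; rewrite mult_INR; unfold d.
  assert (H := INR_fact_neq_0 k); assert (H1 := INR_fact_neq_0 (S N)).
  assert (H' : INR (S k) <> 0) by (apply not_0_INR; lia).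
  field; auto.
Qed.
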